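(* Let $A(\Gamma)$ be an ear RAAG with $\Gamma\neq C_4$, where $C_4$ is the cycle on $4$ vertices, and let $x,y\in A(\Gamma)$ be inner pearls. Suppose that $[x,y]=1$ and that there is $z\in A(\Gamma)$ such that $[x,z]=1$ and $[y,z]\neq 1$. Then $x$ and $y$ form part of a vertex basis of $A(\Gamma)$ such that they arise from adjacent vertices.
   Context: All graphs are finite, undirected and simple. The right-angled Artin group (RAAG) with underlying graph $\Gamma$ is $A(\Gamma)=\langle v\in V(\Gamma)\mid [v,w]=1\text{ whenever }\{v,w\}\in E(\Gamma)\rangle$. An ear is a graph that is a path or a cycle, with more than one vertex; an ear RAAG is a RAAG whose underlying graph is an ear. A vertex basis of $A(\Gamma)$ is a generating set as in the presentation $\langle v\in V(\Gamma)\mid [v,w]=1\text{ whenever }\{v,w\}\in E(\Gamma)\rangle$, i.e. the image $\varphi(V(\Gamma))$ of the standard generators under an automorphism $\varphi$ of $A(\Gamma)$; the element $\varphi(v)$ of this basis is said to arise from the vertex $v$. An inner pearl here is an element $x\in A(\Gamma)$ that is nontrivial, has non-abelian centralizer, and generates the center of its centralizer. *)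

(* Defs.v *)
From HB Require Import structures.
From mathcomp Require Import all_boot.
From mathcomp Require Import boolp classical_sets.

Set Implicit Arguments.
Unset Strict Implicit.
Unset Printing Implicit Defensive.

Local Open Scope group_scope.

(** * Finite simple graphs *)

Record sgraph := SGraph {
  vertex :> finType;
  adj : rel vertex;
  adj_sym : symmetric adj;
  adj_irrefl : irreflexive adj
}.

Definition graph_iso (G H : sgraph) : Prop :=
  exists f : G -> H, bijective f /\ {mono f : u v / adj u v}.

Section PathCycle.
Variable n : nat.

Definition path_adj : rel 'I_n :=
  fun i j => (j == i.+1 :> nat) || (i == j.+1 :> nat).

Lemma path_adj_sym : symmetric path_adj.
Proof. by move=> i j; rewrite /path_adj orbC. Qed.

Lemma path_adj_irrefl : irreflexive path_adj.
Proof. by move=> i; rewrite /path_adj orbb (ltn_eqF (ltnSn i)). Qed.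

Definition path_graph : sgraph := SGraph path_adj_sym path_adj_irrefl.

(* [ordS] is the successor modulo [n].  The clause [i != j] only matters for
   [n = 1]; [cycle_graph n] is the cycle C_n for [n >= 3] only. *)
Definition cycle_adj : rel 'I_n :=
  fun i j => (i != j) && ((j == ordS i) || (i == ordS j)).

Lemma cycle_adj_sym : symmetric cycle_adj.
Proof. by move=> i j; rewrite /cycle_adj orbC eq_sym. Qed.

Lemma cycle_adj_irrefl : irreflexive cycle_adj.
Proof. by move=> i; rewrite /cycle_adj eqxx. Qed.

Definition cycle_graph : sgraph := SGraph cycle_adj_sym cycle_adj_irrefl.

End PathCycle.

Definition is_path (G : sgraph) : Prop :=
  exists n, (2 <= n)%N /\ graph_iso G (path_graph n).

Definition is_cycle (G : sgraph) : Prop :=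
  exists n, (3 <= n)%N /\ graph_iso G (cycle_graph n).

Definition is_ear (G : sgraph) : Prop := is_path G \/ is_cycle G.

(** * Groups given by generators and relators *)

(* The letter [(v, false)] is the generator [v], and [(v, true)] its inverse. *)
Definition letter (V : choiceType) := (V * bool)%type.
Definition word (V : choiceType) := seq (letter V).

Definition inv_letter (V : choiceType) (l : letter V) : letter V :=
  (l.1, ~~ l.2).
Definition inv_word (V : choiceType) (w : word V) : word V :=
  rev (map (@inv_letter V) w).

Section Presentation.
Variables (V : choiceType) (R : set (word V)).

Inductive word_eq : word V -> word V -> Prop :=
| word_eq_refl u : word_eq u u
| word_eq_sym u v : word_eq u v -> word_eq v u
| word_eq_trans v u w : word_eq u v -> word_eq v w -> word_eq u w
| word_eq_cat u u' v v' :
    word_eq u u' -> word_eq v v' -> word_eq (u ++ v) (u' ++ v')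
| word_eq_cancel l : word_eq [:: l; inv_letter l] [::]
| word_eq_relator r : R r -> word_eq r [::].

Definition word_eqb : rel (word V) := fun u v => `[< word_eq u v >].

Lemma word_eqb_refl : reflexive word_eqb.
Proof. by move=> u; apply/asboolP; apply: word_eq_refl. Qed.

Lemma word_eqb_sym : symmetric word_eqb.
Proof. by move=> u v; apply/asboolP/asboolP; apply: word_eq_sym. Qed.

Lemma word_eqb_trans : transitive word_eqb.
Proof.
move=> v u w /asboolP uv /asboolP vw.
by apply/asboolP; apply: word_eq_trans uv vw.
Qed.

Canonical word_equiv := EquivRel word_eqb word_eqb_refl word_eqb_sym
  word_eqb_trans.

Definition presented : Type := {eq_quot word_equiv}%qT.
HB.instance Definition _ :=
  Choice.copy presented {eq_quot word_equiv}%qT.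

Definition class_of_word (w : word V) : presented :=
  (\pi_({eq_quot word_equiv}) w)%qT.

Definition word_of_class (x : presented) : word V :=
  repr (x : {eq_quot word_equiv}%qT).

Lemma word_of_classK : cancel word_of_class class_of_word.
Proof. by move=> x; apply: reprK. Qed.

Lemma class_of_wordP u v : class_of_word u = class_of_word v <-> word_eq u v.
Proof.
split; first by move/eqmodP/asboolP.
by move=> uv; apply/eqmodP/asboolP.
Qed.

Lemma word_of_class_eq w : word_eq (word_of_class (class_of_word w)) w.
Proof. by apply/class_of_wordP; rewrite word_of_classK. Qed.

Lemma inv_letterK : involutive (@inv_letter V).
Proof. by case=> v b; rewrite /inv_letter /= negbK. Qed.

Lemma inv_wordK : involutive (@inv_word V).
Proof.
by move=> w; rewrite /inv_word -map_rev revK -map_comp map_id_in // => l _ /=;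
   rewrite inv_letterK.
Qed.

Lemma word_eq_mulV w : word_eq (w ++ inv_word w) [::].
Proof.
elim: w => [|l w IHw]; first exact: word_eq_refl.
rewrite /inv_word /= rev_cons -cats1 -/(inv_word w).
apply: word_eq_trans (word_eq_cancel l).
have := word_eq_cat (word_eq_refl [:: l])
          (word_eq_cat IHw (word_eq_refl [:: inv_letter l])).
by rewrite /= -catA.
Qed.

Lemma word_eq_inv u v : word_eq u v -> word_eq (inv_word u) (inv_word v).
Proof.
move=> uv.
have Vvv : word_eq (inv_word v ++ v) [::].
  by have := word_eq_mulV (inv_word v); rewrite inv_wordK.
apply: (@word_eq_trans ((inv_word v ++ v) ++ inv_word u)).
  rewrite -[X in word_eq X _]cat0s.
  exact: word_eq_cat (word_eq_sym Vvv) (word_eq_refl _).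
rewrite -catA -[X in word_eq _ X]cats0.
apply: word_eq_cat (word_eq_refl _) _.
apply: word_eq_trans (word_eq_mulV u).
exact: word_eq_cat (word_eq_sym uv) (word_eq_refl _).
Qed.

Definition pres_one : presented := class_of_word [::].
Definition pres_mul (x y : presented) : presented :=
  class_of_word (word_of_class x ++ word_of_class y).
Definition pres_inv (x : presented) : presented :=
  class_of_word (inv_word (word_of_class x)).

Lemma pres_mulE u v :
  pres_mul (class_of_word u) (class_of_word v) = class_of_word (u ++ v).
Proof.
by apply/class_of_wordP; apply: word_eq_cat; apply: word_of_class_eq.
Qed.

Lemma pres_invE u : pres_inv (class_of_word u) = class_of_word (inv_word u).
Proof. by apply/class_of_wordP/word_eq_inv/word_of_class_eq. Qed.

Lemma pres_mulA : associative pres_mul.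
Proof.
move=> x y z; rewrite -(word_of_classK x) -(word_of_classK y).
by rewrite -(word_of_classK z) !pres_mulE catA.
Qed.

Lemma pres_1mul : left_id pres_one pres_mul.
Proof. by move=> x; rewrite -(word_of_classK x) pres_mulE. Qed.

Lemma pres_mul1 : right_id pres_one pres_mul.
Proof. by move=> x; rewrite -(word_of_classK x) pres_mulE cats0. Qed.

Lemma pres_mulV : right_inverse pres_one pres_inv pres_mul.
Proof.
move=> x; rewrite -(word_of_classK x) pres_invE pres_mulE.
by apply/class_of_wordP/word_eq_mulV.
Qed.

Lemma pres_Vmul : left_inverse pres_one pres_inv pres_mul.
Proof.
move=> x; rewrite -(word_of_classK x) pres_invE pres_mulE.
apply/class_of_wordP.
by have := word_eq_mulV (inv_word (word_of_class x)); rewrite inv_wordK.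
Qed.

HB.instance Definition _ := isGroup.Build presented
  pres_mulA pres_1mul pres_mul1 pres_Vmul pres_mulV.

Definition pres_gen (v : V) : presented := class_of_word [:: (v, false)].

End Presentation.

(** * Right-angled Artin groups *)

Definition comm_word (V : choiceType) (v w : V) : word V :=
  [:: (v, true); (w, true); (v, false); (w, false)].

Definition raag_relators (G : sgraph) : set (word G) :=
  [set r | exists v w : G, adj v w /\ r = comm_word v w].

Definition raag (G : sgraph) : groupType := presented (@raag_relators G).

Definition raag_gen (G : sgraph) (v : G) : raag G :=
  pres_gen (@raag_relators G) v.

(* A vertex basis is indexed by the vertices from which its elements arise. *)
Definition is_vertex_basis (G : sgraph) (B : G -> raag G) : Prop :=
  exists phi : {multiplicative raag G -> raag G},
    bijective phi /\ forall v, B v = phi (raag_gen v).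

(** * Centralizers and inner pearls *)

Section InnerPearl.
Variable A : groupType.

Definition centralizer (x : A) : set A := [set g | commute x g].

Definition is_abelian (S : set A) : Prop :=
  forall g h, S g -> S h -> commute g h.

Definition center (S : set A) : set A :=
  [set g | S g /\ forall h, S h -> commute g h].

Definition cyclic_subgroup (x : A) : set A :=
  [set g | exists n : nat, g = x ^+ n \/ g = x ^- n].

Definition inner_pearl (x : A) : Prop :=
  [/\ x <> 1, ~ is_abelian (centralizer x)
    & cyclic_subgroup x = center (centralizer x)].

End InnerPearl.

(* Main.v *)
Require Import Defs.
From HB Require Import structures.
From mathcomp Require Import all_boot.
From mathcomp Require Import zify boolp classical_sets.

(* Write a conjugate of x as a cyclically reduced word t.  If g commutes with t,
   then for large n the reduced form h of g t^n satisfies h t = t h as traces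
   (words up to exchanges of adjacent commuting letters), so that the
   projections of h and t to any two non-adjacent vertices commute in a free
   monoid.  When no two vertices have two common neighbours, this forces the
   centralizer of t to be abelian as soon as t involves two vertices.  An inner
   pearl is therefore conjugate to a power of a vertex, and in fact to a vertex
   or its inverse, as the centralizer of a vertex is that of its powers.

   Conjugate x to a letter on the vertex v.  Then y lies in the centralizer of
   v, which is generated by the star of v, and the same argument run inside the
   star conjugates y to a letter on a vertex w of the star by an element
   centralizing v.  The element z rules out w = v.  Flipping the signs of v and
   w and conjugating is an automorphism sending v and w to x and y. *)

Set Implicit Arguments.
Unset Strict Implicit.
Unset Printing Implicit Defensive.

Local Open Scope group_scope.

(** * Commuting words in a free monoid *)

Section CommutingSequences.
Variable T : eqType.
Implicit Types s t u : seq T.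

Lemma comm_cat_flatten s u n : s ++ u = u ++ s ->
  s ++ flatten (nseq n u) = flatten (nseq n u) ++ s.
Proof. by move=> su; elim: n => [|n IHn] /=; rewrite ?cats0 // catA su -!catA IHn. Qed.

Lemma comm_cat_take s u : s ++ u = u ++ s -> size s <= size u ->
  s = take (size s) u.
Proof.
by move=> su le_su; rewrite -[LHS](take_size_cat u (erefl (size s))) su takel_cat.
Qed.

(** Since [s] commutes with every power of [u], it is a prefix of any power at least as long; as [u]
    is nonempty, [size s] copies are enough. *)
Lemma comm_cat_prefix s u : u != [::] -> s ++ u = u ++ s -> forall n, size s <= n ->
  s = take (size s) (flatten (nseq n u)).
Proof.
move=> u_n0 su n le_sn; apply: comm_cat_take; first exact: comm_cat_flatten.
rewrite size_flatten /shape map_nseq sumn_nseq (leq_trans le_sn) //.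
by rewrite leq_pmull // lt0n size_eq0.
Qed.

Lemma comm_cat_sub s u : u != [::] -> s ++ u = u ++ s -> {subset s <= u}.
Proof.
move=> u_n0 su x; rewrite (comm_cat_prefix u_n0 su (leqnn _)) => /mem_take.
by move=> /flattenP[v /nseqP[-> _]].
Qed.

(** Both products commute with [u] and have the same length, so they are the same prefix of a power
    of [u]. *)
Lemma comm_cat_trans s t u : u != [::] ->
  s ++ u = u ++ s -> t ++ u = u ++ t -> s ++ t = t ++ s.
Proof.
move=> u_n0 su tu.
rewrite (comm_cat_prefix (s := s ++ t) u_n0 _ (leqnn _)); last by rewrite -catA tu !catA su.
rewrite (comm_cat_prefix (s := t ++ s) u_n0 _ (leqnn _)); last by rewrite -catA su !catA tu.
by rewrite !size_cat addnC.
Qed.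

End CommutingSequences.

(** * Reduced words up to trace equivalence *)

Section Traces.
Variable G : sgraph.
Implicit Types (a b c d v : G) (l m : letter G) (u w s t : word G).

Definition proj a b w : word G := [seq l <- w | (l.1 == a) || (l.1 == b)].

Lemma proj_cat a b u w : proj a b (u ++ w) = proj a b u ++ proj a b w.
Proof. exact: filter_cat. Qed.

(* Two words are identified when they differ by exchanges of adjacent letters
   on adjacent vertices; for partially commutative monoids this is the same
   as having equal projections on all pairs of non-adjacent (possibly equal)
   vertices. *)
Definition teq u w := forall a b, ~~ adj a b -> proj a b u = proj a b w.

Lemma teq_refl w : teq w w. Proof. by []. Qed.

Lemma teq_sym u w : teq u w -> teq w u.
Proof. by move=> uw a b ab; rewrite uw. Qed.

Lemma teq_trans w u t : teq u w -> teq w t -> teq u t.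
Proof. by move=> uw wt a b ab; rewrite uw ?wt. Qed.

Lemma teq_cat u u' w w' : teq u u' -> teq w w' -> teq (u ++ w) (u' ++ w').
Proof. by move=> uu' ww' a b ab; rewrite !proj_cat uu' ?ww'. Qed.

Lemma teq_cons l u w : teq u w -> teq (l :: u) (l :: w).
Proof. exact: (@teq_cat [:: l] [:: l]). Qed.

Lemma teq_rev u w : teq u w -> teq (rev u) (rev w).
Proof. by move=> uw a b /uw; rewrite /proj !filter_rev => ->. Qed.

Lemma teq_consI l u w : teq (l :: u) (l :: w) -> teq u w.
Proof.
move=> uw a b /uw.
by rewrite -cat1s -[l :: w]cat1s !proj_cat => /eqP; rewrite eqseq_cat ?eqxx // => /eqP.
Qed.

(** A vertex is not adjacent to itself, so the projection to the pair [l.1], [l.1] is available and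
    counts the occurrences of [l]. *)
Lemma teq_perm u w : teq u w -> perm_eq u w.
Proof.
move=> uw; apply/allP=> l _ /=; apply/eqP.
have := uw l.1 l.1; rewrite adj_irrefl => /(_ isT) E.
have P t : count_mem l t = count_mem l (proj l.1 l.1 t).
  rewrite count_filter; apply: eq_count => m /=.
  by case: eqP => [->|] //=; rewrite eqxx.
by rewrite P E -P.
Qed.

Lemma teq_mem u w : teq u w -> u =i w.
Proof. by move/teq_perm/perm_mem. Qed.

Lemma teq_size u w : teq u w -> size u = size w.
Proof. by move/teq_perm/perm_size. Qed.

Lemma teq_swap l m w : adj l.1 m.1 -> teq (l :: m :: w) (m :: l :: w).
Proof.
move=> lm a b ab; rewrite /proj /=.
case: (boolP ((l.1 == a) || (l.1 == b))) => // la.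
case: (boolP ((m.1 == a) || (m.1 == b))) => // ma.
case/orP: la ma lm ab => /eqP<- /orP[] /eqP<-;
  by rewrite ?adj_irrefl // => lm; rewrite ?[adj m.1 _]adj_sym lm.
Qed.

(** Exchanges can bring [l] to the front of [w]: every letter before its first occurrence is on a
    vertex adjacent to [l.1]. *)
Fixpoint acc l w :=
  if w is m :: w' then (m == l) || adj l.1 m.1 && acc l w' else false.

(** Expressing [acc] through projections makes its invariance under [teq] immediate. *)
Lemma acc_projP l w :
  reflect (forall b, ~~ adj l.1 b -> ohead (proj l.1 b w) = Some l) (acc l w).
Proof.
apply: (iffP idP) => [|H]; last first.
  elim: w H => [|m w IHw] H /=; first by have := H l.1; rewrite adj_irrefl => /(_ isT).
  case: eqVneq => //= ml; case: (boolP (adj l.1 m.1)) => lm /=; last first.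
    by have := H _ lm; rewrite /proj /= eqxx orbT /= => -[/eqP]; rewrite (negPf ml).
  apply: IHw => b lb; rewrite -(H b lb) /proj /=.
  case: ifP => // /orP[] /eqP E; first by rewrite E adj_irrefl in lm.
  by rewrite -E lm in lb.
elim: w => //= m w IHw /orP[/eqP->|/andP[lm lw]] b lb.
  by rewrite /proj /= eqxx.
rewrite -(IHw lw b lb) /proj /=.
case: ifP => // /orP[] /eqP E; first by rewrite E adj_irrefl in lm.
by rewrite -E lm in lb.
Qed.

Lemma acc_teq l u w : teq u w -> acc l u = acc l w.
Proof.
move=> uw; apply/acc_projP/acc_projP => H b lb; last by rewrite uw ?H.
by rewrite -uw ?H.
Qed.

Lemma acc_mem l w : acc l w -> l \in w.
Proof.
elim: w => //= m w IHw; rewrite inE eq_sym; case: eqP => //= _ /andP[_].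
exact: IHw.
Qed.

Lemma acc_cat l u w :
  acc l (u ++ w) = acc l u || all (fun m => adj l.1 m.1) u && acc l w.
Proof.
elim: u => //= m u ->; case: (m == l) => //=.
by rewrite andb_orr andbA.
Qed.

Lemma acc_rem l w : acc l w -> teq w (l :: rem l w).
Proof.
elim: w => //= m w IHw; case: eqP => [->|_] //= /andP[lm /IHw wE].
apply: teq_trans (teq_cons m wE) _.
by apply: teq_swap; rewrite adj_sym.
Qed.

Lemma inv_letter_neq l : (inv_letter l == l) = false.
Proof. by case: l => v b; rewrite /inv_letter xpair_eqE /= eqxx; case: b. Qed.

Lemma adjN_neq l m : adj l.1 m.1 -> (m == l) = false.
Proof. by move=> lm; apply: contraTF lm => /eqP->; rewrite adj_irrefl. Qed.

(** Left multiplication by a letter on reduced words, cancelling when the inverse letter can be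
    brought to the front. *)
Definition push l w :=
  if acc (inv_letter l) w then rem (inv_letter l) w else l :: w.

Fixpoint reduced w :=
  if w is l :: w' then ~~ acc (inv_letter l) w' && reduced w' else true.

Definition red w := foldr push [::] w.

Lemma push_teq l u w : teq u w -> teq (push l u) (push l w).
Proof.
move=> uw; rewrite /push (acc_teq _ uw).
case: ifP => [|_]; last exact: teq_cons.
move=> lw; apply: (@teq_consI (inv_letter l)).
have lu : acc (inv_letter l) u by rewrite (acc_teq _ uw).
apply: teq_trans (acc_rem lw).
exact: teq_trans (teq_sym (acc_rem lu)) uw.
Qed.

Lemma reduced_rem l w : reduced w -> acc l w -> reduced (rem l w).
Proof.
elim: w => //= m w IHw /andP[mw rw]; case: eqP => //= _ /andP[lm lw].
rewrite IHw // andbT; apply: contra mw => mw.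
by rewrite (acc_teq _ (acc_rem lw)) /= adj_sym lm mw orbT.
Qed.

Lemma reduced_push l w : reduced w -> reduced (push l w).
Proof.
move=> rw; rewrite /push; case: ifP => [|/= ->] //.
exact: reduced_rem.
Qed.

Lemma reduced_red w : reduced (red w).
Proof. by elim: w => //= l w; apply: reduced_push. Qed.

Lemma red_id w : reduced w -> red w = w.
Proof. by elim: w => //= l w IHw /andP[/negPf lw /IHw->]; rewrite /push lw. Qed.

Lemma reduced_rem_acc l w : reduced w -> acc l w ->
  ~~ acc (inv_letter l) (rem l w).
Proof.
elim: w => //= m w IHw /andP[mw rw]; case: eqP => [<-|_] //= /andP[lm lw].
by rewrite adjN_neq //= lm /= IHw.
Qed.

Lemma pushK l w : reduced w -> teq (push l (push (inv_letter l) w)) w.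
Proof.
move=> rw; rewrite {2}/push inv_letterK; case: ifP => lw.
  by rewrite /push (negPf (reduced_rem_acc rw lw)); apply/teq_sym/acc_rem.
by rewrite /push /= eqxx.
Qed.

Lemma acc_push l m w : adj l.1 m.1 -> acc l (push m w) = acc l w.
Proof.
move=> lm; rewrite /push; case: ifP => [mw|_] /=; last by rewrite adjN_neq // lm.
by rewrite [in RHS](acc_teq _ (acc_rem mw)) /= adjN_neq //= lm.
Qed.

Lemma pushC l m w : adj l.1 m.1 -> teq (push l (push m w)) (push m (push l w)).
Proof.
move=> lm; have ml : adj m.1 l.1 by rewrite adj_sym.
rewrite {1}/push [in X in teq _ X]/push !acc_push //.
case: ifP => lw; case: ifP => mw; rewrite /push ?lw ?mw.
(* When both letters cancel, restoring the two inverse letters turns either side back into [w]. *)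
- apply: (@teq_consI (inv_letter m)); apply: (@teq_consI (inv_letter l)).
  have lmw : acc (inv_letter l) (rem (inv_letter m) w).
    by rewrite -(@acc_push (inv_letter l) m) // /push mw in lw.
  have mlw : acc (inv_letter m) (rem (inv_letter l) w).
    by rewrite -(@acc_push (inv_letter m) l) // /push lw in mw.
  apply: teq_trans (teq_swap _ _) _ => //.
  apply: (@teq_trans w); last first.
    exact: teq_trans (acc_rem lw) (teq_cons _ (acc_rem mlw)).
  apply: teq_sym.
  exact: teq_trans (acc_rem mw) (teq_cons _ (acc_rem lmw)).
- by rewrite /= adjN_neq.
- by rewrite /= adjN_neq.
- exact: teq_swap.
Qed.

Notation weq := (@word_eq G (@raag_relators G)).

Lemma foldr_push_teq u w t : teq w t -> teq (foldr push w u) (foldr push t u).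
Proof. by elim: u => //= l u IHu /IHu; apply: push_teq. Qed.

Lemma reduced_foldr_push u w : reduced w -> reduced (foldr push w u).
Proof. by elim: u => //= l u IHu /IHu; apply: reduced_push. Qed.

(** By [pushK] and [pushC] the defining relations act trivially, so the group acts on reduced words
    modulo [teq]. Acting on the empty word gives uniqueness of normal forms. *)
Lemma word_eq_push u w : weq u w ->
  forall t, reduced t -> teq (foldr push t u) (foldr push t w).
Proof.
elim=> {u w} [u t _|u w _ IH t rt|w u t _ IH1 _ IH2 s rs|
  u u' w w' _ IHu _ IHw t rt|l t rt|r [a [b [ab ->]]] t rt].
- exact: teq_refl.
- exact/teq_sym/IH.
- exact: teq_trans (IH1 _ rs) (IH2 _ rs).
- rewrite !foldr_cat; apply: (@teq_trans (foldr push (foldr push t w) u')).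
    exact/IHu/reduced_foldr_push.
  exact/foldr_push_teq/IHw.
- exact: pushK.
- rewrite /comm_word /=.
  apply: teq_trans (push_teq _ (pushC _ _)) _; first by rewrite /= adj_sym.
  have rt' := reduced_push (b, false) rt.
  apply: (@teq_trans
    (push (a, true) (push (a, false) (push (b, true) (push (b, false) t))))).
    by [].
  apply: teq_trans (@pushK (a, true) _ _) _; first by do 2!apply: reduced_push.
  exact: (@pushK (b, true)).
Qed.

Lemma word_eq_red u w : weq u w -> teq (red u) (red w).
Proof. by move=> /word_eq_push; apply. Qed.

End Traces.

(** * Normal forms of group elements *)

Section NormalForms.
Variable G : sgraph.
Implicit Types (a b v : G) (l m : letter G) (u w s t : word G) (g x y : raag G).

Local Notation weq := (@word_eq G (@raag_relators G)).

Definition cls w : raag G := class_of_word (@raag_relators G) w.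

Lemma cls_cat u w : cls (u ++ w) = cls u * cls w.
Proof. by rewrite /cls -pres_mulE. Qed.

Lemma cls_cons l w : cls (l :: w) = cls [:: l] * cls w.
Proof. exact: (@cls_cat [:: l]). Qed.

Lemma cls_nil : cls [::] = 1.
Proof. by []. Qed.

Lemma cls_inv_word w : cls (inv_word w) = (cls w)^-1.
Proof. exact: (esym (pres_invE (@raag_relators G) w)). Qed.

Lemma cls_inv_letter l : cls [:: inv_letter l] = (cls [:: l])^-1.
Proof. exact: (cls_inv_word [:: l]). Qed.

Lemma cls_flatten_nseq n w : cls (flatten (nseq n w)) = cls w ^+ n.
Proof. by elim: n => //= n IHn; rewrite cls_cat IHn expgS. Qed.

Lemma cls_nseq n l : cls (nseq n l) = cls [:: l] ^+ n.
Proof. by elim: n => //= n IHn; rewrite cls_cons IHn expgS. Qed.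

Lemma cls_adjC l m : adj l.1 m.1 -> commute (cls [:: l]) (cls [:: m]).
Proof.
have gen a b : adj a b -> commute (cls [:: (a, false)]) (cls [:: (b, false)]).
  move=> ab; apply/commgP/eqP.
  have : cls (comm_word a b) = 1.
    by apply/class_of_wordP/word_eq_relator; exists a, b.
  rewrite /comm_word cls_cons (cls_cons (b, true)) (cls_cons (a, false)).
  by rewrite (cls_inv_letter (a, false)) (cls_inv_letter (b, false)).
have sgn a e : cls [:: (a, e)] = cls [:: (a, false)] \/
    cls [:: (a, e)] = (cls [:: (a, false)])^-1.
  by case: e; [right; rewrite -cls_inv_letter | left].
case: l m => [a e] [b f] /= /gen ab.
case: (sgn a e) (sgn b f) => -> [] -> //; first exact: commuteV.
  exact/commute_sym/commuteV/commute_sym.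
exact/commuteV/commute_sym/commuteV/commute_sym.
Qed.

Lemma cls_same_vertex l m : l.1 = m.1 ->
  cls [:: m] = cls [:: l] \/ cls [:: m] = (cls [:: l])^-1.
Proof.
case: (eqVneq m l) => [-> _|ml lm1]; [by left | right].
rewrite -cls_inv_letter; congr (cls [:: _]).
by case: l m ml lm1 => [a []] [b []] //= + ab; rewrite ab ?eqxx.
Qed.

Lemma cls_same_vertexC l m : l.1 = m.1 -> commute (cls [:: l]) (cls [:: m]).
Proof. by case/cls_same_vertex=> ->; [|apply: commuteV]; apply: commute_refl. Qed.

Lemma commute_cls g w :
  (forall l, l \in w -> commute g (cls [:: l])) -> commute g (cls w).
Proof.
elim: w => [_|l w IHw H]; first exact: commute1.
rewrite cls_cons; apply: commuteM; first by apply: H; rewrite inE eqxx.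
by apply: IHw => m mw; apply: H; rewrite inE mw orbT.
Qed.

Lemma commute_cls2 u w :
  (forall l m, l \in u -> m \in w -> commute (cls [:: l]) (cls [:: m])) ->
  commute (cls u) (cls w).
Proof.
move=> H; apply: commute_cls => m mw; apply/commute_sym/commute_cls => l lu.
exact/commute_sym/H.
Qed.

Lemma cls_acc l w : acc l w -> cls w = cls [:: l] * cls (rem l w).
Proof.
elim: w => //= m w IHw; case: eqP => [-> _|_] /=; first exact: cls_cons.
case/andP=> lm /IHw E; rewrite cls_cons E (cls_cons m (rem _ _)) !mulgA.
by rewrite (cls_adjC lm).
Qed.

Lemma cls_teq u w : teq u w -> cls u = cls w.
Proof.
elim: u w => [|l u IHu] w uw; first by move/teq_size: uw => /esym/size0nil->.
have lw : acc l w by rewrite -(acc_teq _ uw) /= eqxx.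
rewrite (cls_acc lw) cls_cons; congr (_ * _); apply: IHu.
by apply: (@teq_consI _ l); apply: teq_trans (acc_rem lw).
Qed.

Lemma cls_push l w : cls (push l w) = cls (l :: w).
Proof.
rewrite /push; case: ifP => // /cls_acc E; rewrite cls_cons E cls_inv_letter.
by rewrite mulVKg.
Qed.

Lemma cls_red w : cls (red w) = cls w.
Proof. by elim: w => //= l w IHw; rewrite cls_push cls_cons IHw -cls_cons. Qed.

Lemma cls_eq_red u w : cls u = cls w -> teq (red u) (red w).
Proof. by move=> /class_of_wordP; apply: word_eq_red. Qed.

Lemma cls_eq_reduced u w : reduced u -> reduced w -> cls u = cls w -> teq u w.
Proof. by move=> ru rw /cls_eq_red; rewrite !red_id. Qed.

Lemma cls_surj g : exists2 w, reduced w & g = cls w.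
Proof.
exists (red (word_of_class g)); first exact: reduced_red.
by rewrite cls_red /cls word_of_classK.
Qed.

Lemma push_sub l w : {subset push l w <= l :: w}.
Proof.
move=> m; rewrite /push; case: ifP => // _ /mem_rem.
by rewrite inE orbC => ->.
Qed.

Lemma red_sub w : {subset red w <= w}.
Proof.
elim: w => //= l w IHw m /push_sub; rewrite !inE => /orP[->|/IHw->] //.
by rewrite orbT.
Qed.

Lemma size_push l w : size (push l w) <= (size w).+1.
Proof.
rewrite /push; case: ifP => // /acc_mem /size_rem->.
exact: leq_trans (leq_pred _) (leqnSn _).
Qed.

Lemma size_red w : size (red w) <= size w.
Proof. by elim: w => //= l w IHw; apply: leq_trans (size_push _ _) _; rewrite ltnS. Qed.

(** Any cancellation made by [red] shortens the word, so full length means that none occurred. *)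
Lemma size_red_reduced w : size w <= size (red w) -> reduced w.
Proof.
elim: w => //= l w IHw le_w.
have rw : reduced w by apply: IHw; rewrite -ltnS; apply: leq_trans le_w (size_push _ _).
rewrite red_id // in le_w; rewrite rw andbT; apply: contraTN le_w => lw.
rewrite /push lw size_rem ?acc_mem // -ltnNge.
by apply: leq_ltn_trans (leq_pred _) _.
Qed.

Lemma reduced_size u w : reduced u -> cls u = cls w -> size u <= size w.
Proof. by move=> ru /cls_eq_red; rewrite red_id // => /teq_size->; apply: size_red. Qed.

(** A cancellation across the junction pairs a letter that can move to the end of [u], which is what
    [acc l (rev u)] says, with an inverse that can move to the front of [w]. *)
Lemma reduced_cat u w : reduced u -> reduced w ->
  (forall l, acc l (rev u) -> ~~ acc (inv_letter l) w) -> reduced (u ++ w).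
Proof.
elim: u => //= m u IHu /andP[mu ru] rw H; rewrite IHu // => [|l lu]; last first.
  by apply: H; rewrite rev_cons -cats1 acc_cat lu.
rewrite andbT acc_cat (negPf mu) /=; apply/negP=> /andP[mu' mw].
have := H m; rewrite rev_cons -cats1 acc_cat /= eqxx andbT mw.
by rewrite all_rev (_ : all _ u) ?orbT => [/(_ isT)|].
Qed.

Definition cyclically_reduced w :=
  reduced w && ~~ has (fun l => acc l (rev w) && acc (inv_letter l) w) w.

Lemma cyclically_reduced_pow w n :
  cyclically_reduced w -> reduced (flatten (nseq n w)).
Proof.
case/andP=> rw /hasPn H; elim: n => //= n IHn; apply: reduced_cat => // l lw.
have lw' : l \in w by rewrite -mem_rev acc_mem.
have n_lw : ~~ acc (inv_letter l) w by have := H l lw'; rewrite lw.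
(* The inverse of [l] cannot come from a later copy of [w] either: it would have to pass the [l] in
   the first copy. *)
case: n {IHn} => //= n; rewrite acc_cat (negPf n_lw) /=; apply/nandP; left.
by apply/allPn; exists l; rewrite //= adj_irrefl.
Qed.

(** Strip a letter at the end and its inverse at the front, by induction on length. Tracking [S]
    keeps the conjugator inside a given vertex set, later the star of a vertex. *)
Lemma conj_cyclically_reduced (S : pred G) w : all (fun l => S l.1) w ->
  exists c t, [/\ all (fun l => S l.1) c, all (fun l => S l.1) t,
    cyclically_reduced t & cls w = cls t ^ cls c].
Proof.
have [n] := ubnP (size w); elim: n w => // n IHn w; rewrite ltnS => le_wn Sw.
wlog rw : w le_wn Sw / reduced w.
  move=> H; rewrite -cls_red; apply: H (reduced_red w).
    exact: leq_trans (size_red w) le_wn.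
  by apply/allP=> l /red_sub; apply: (allP Sw).
have [|ncw] := boolP (cyclically_reduced w).
  by exists [::], w; split=> //; rewrite cls_nil conjg1.
move: ncw; rewrite /cyclically_reduced rw negbK => /hasP[l lw /andP[l_end l_beg]].
set w' := rem (inv_letter l) w.
have wE : teq w (inv_letter l :: w') by apply: acc_rem.
(* The letter removed from the front differs from [l], so [l] can still reach the end. *)
have : acc l (rev w').
  move: l_end; rewrite (acc_teq _ (teq_rev wE)) rev_cons -cats1 acc_cat.
  by rewrite /= inv_letter_neq andbF andbF orbF.
move=> /acc_rem/teq_rev; rewrite revK rev_cons -cats1.
set t := rev _ => w'E.
have clsw : cls w = cls t ^ cls [:: l].
  rewrite (cls_teq wE) cls_cons (cls_teq w'E) cls_cat cls_inv_letter.
  by rewrite conjgE mulgA.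
have sz : size w = (size t).+2.
  by rewrite (teq_size wE) /= (teq_size w'E) size_cat addn1.
have St : all (fun l => S l.1) t.
  apply/allP=> m mt; apply: (allP Sw); rewrite (teq_mem wE) inE.
  by rewrite (teq_mem w'E) mem_cat mt orbT.
have [|c [s [Sc Ss cs E]]] := IHn t _ St.
  by rewrite sz in le_wn; apply: leq_trans le_wn.
exists (c ++ [:: l]), s; split=> //; last by rewrite clsw E cls_cat conjgM.
by rewrite all_cat Sc /= (allP Sw l lw).
Qed.

Lemma slope_attained (f : nat -> nat) (k b : nat) :
  (forall n, f n.+1 <= f n + k) -> (forall n, n * k <= f n + b) ->
  exists n, f n.+1 = f n + k.
Proof.
move=> f_step f_lb.
(* Here [e] bounds the slack [f n + b - n * k], which is nonnegative and drops at every increment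
   below [k]. *)
suff H e n : f n + b <= n * k + e -> exists n, f n.+1 = f n + k.
  by apply: (H (f 0 + b) 0); rewrite mul0n.
elim: e n => [|e IHe] n; have := f_step n; have := f_lb n.+1; rewrite mulSn.
  by exists n; lia.
have [fn|fn] := eqVneq (f n.+1) (f n + k); first by exists n.
by move=> *; apply: (IHe n.+1); rewrite mulSn; lia.
Qed.

(* With h_n the reduced form of [g * t^n], the defect n|t| - |h_n| is
   nondecreasing and bounded by |g|, hence eventually constant; from then on
   neither [h_n t] nor [t h_n] has any cancellation. *)
Lemma commute_cyclically_reduced t g : cyclically_reduced t ->
  commute (cls t) g ->
  exists n h, g * cls t ^+ n = cls h /\ teq (h ++ t) (t ++ h).
Proof.
move=> ct tg; pose wd n := g * cls t ^+ n.
have clsK n : cls (red (word_of_class (wd n))) = wd n.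
  by rewrite cls_red /cls word_of_classK.
have [w rw gE] := cls_surj g.
have [|n|n fn] := @slope_attained
    (fun n => size (red (word_of_class (wd n)))) (size t) (size w).
- move=> n; rewrite -size_cat; apply: reduced_size; first exact: reduced_red.
  by rewrite cls_cat !clsK /wd expgSr mulgA.
(* The reduced power of [t] equals the inverse of [g] times h_n, so its length is at most that of
   h_n plus that of [w]. *)
- rewrite addnC -(size_rev w) -(size_map (@inv_letter _) (rev w)) -size_cat.
  have -> : (n * size t)%N = size (flatten (nseq n t)).
    by rewrite size_flatten /shape map_nseq sumn_nseq mulnC.
  apply: reduced_size; first exact: cyclically_reduced_pow.
  rewrite cls_flatten_nseq cls_cat clsK /wd map_rev.
  by rewrite -/(inv_word w) cls_inv_word -gE mulKg.
exists n, (red (word_of_class (wd n))); rewrite clsK; split=> //.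
set h := red (word_of_class (wd n)) in fn *.
have hx : cls (h ++ t) = wd n.+1 by rewrite cls_cat clsK /wd expgSr mulgA.
have xh : cls (t ++ h) = wd n.+1.
  rewrite cls_cat clsK /wd mulgA tg -mulgA expgS //.
apply: cls_eq_reduced; last by rewrite hx xh.
  apply: size_red_reduced; rewrite size_cat -fn; apply: reduced_size.
    exact: reduced_red.
  by rewrite clsK cls_red.
apply: size_red_reduced; rewrite size_cat addnC -fn; apply: reduced_size.
  exact: reduced_red.
by rewrite clsK cls_red.
Qed.

End NormalForms.

(** * Centralizers and inner pearls *)

Lemma commute_mulrI (A : groupType) (x y z : A) :
  commute x (y * z) -> commute x z -> commute x y.
Proof. by move=> xyz /commuteV xz; rewrite -[y](mulgK z); apply: commuteM. Qed.

Lemma commuteJ (A : groupType) (x y g : A) : commute (x ^ g) (y ^ g) <-> commute x y.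
Proof. by rewrite /commute -!conjMg; split=> [/conjg_inj|->]. Qed.

Lemma inner_pearlJ (A : groupType) (x g : A) : inner_pearl x -> inner_pearl (x ^ g).
Proof.
case=> x_n1 x_nab x_cyc; split.
- by move/eqP; rewrite conjg_eq1 => /eqP.
- move=> xg_ab; apply: x_nab => h k xh xk; apply/(commuteJ _ _ g).
  by apply: xg_ab; apply/commuteJ.
apply/predeqP=> h; rewrite -[h](conjgKV g); set k := h ^ _.
have -> : cyclic_subgroup (x ^ g) (k ^ g) <-> cyclic_subgroup x k.
  rewrite /cyclic_subgroup /=; split=> -[n E]; exists n.
    by move: E; rewrite -!conjXg -!conjVg => -[] /conjg_inj->; [left | right].
  by rewrite -!conjXg -!conjVg; case: E => ->; [left | right].
rewrite x_cyc; split=> -[xk kC]; split.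
- exact/commuteJ.
- move=> j xj; rewrite -[j](conjgKV g); apply/commuteJ/kC/(commuteJ _ _ g).
  by rewrite conjgKV.
- exact/(commuteJ _ _ g).
- by move=> j xj; apply/(commuteJ _ _ g)/kC/commuteJ.
Qed.

Section Centralizers.
Variable G : sgraph.
Implicit Types (a b v : G) (l m : letter G) (u w s t h : word G) (g x y : raag G).

(** Absence of 4-cycles as subgraphs, induced or not. *)
Definition squarefree :=
  forall p q a b : G, adj p a -> adj p b -> adj q a -> adj q b -> p = q \/ a = b.

(** The projections of [h] and [t] to [l.1] and [m.1] commute and the second contains [m], so it
    contains every letter of the first. *)
Lemma commuting_trace_sub h t l m : teq (h ++ t) (t ++ h) ->
  l \in h -> m \in t -> ~~ adj l.1 m.1 -> l \in t.
Proof.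
move=> ht lh mt lm; have := ht _ _ lm; rewrite !proj_cat => /comm_cat_sub E.
suff : l \in proj l.1 m.1 t by rewrite mem_filter => /andP[].
apply: E; last by rewrite mem_filter eqxx.
apply: contraTneq (mt) => E; suff : m \notin proj l.1 m.1 t.
  by rewrite mem_filter eqxx orbT.
by rewrite E.
Qed.

Lemma cls_filter_split (P : pred (letter G)) w :
  (forall l m, l \in w -> m \in w -> P l -> ~~ P m ->
    commute (cls [:: l]) (cls [:: m])) ->
  cls w = cls (filter P w) * cls (filter (predC P) w).
Proof.
elim: w => [|l w IHw] H /=; first by rewrite cls_nil mulg1.
rewrite cls_cons IHw => [|p m pw mw]; last first.
  by apply: H; rewrite inE (pw, mw) orbT.
case: ifPn => Pl /=; rewrite (cls_cons l (filter _ _)) !mulgA //; congr (_ * _).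
apply: commute_cls => m; rewrite mem_filter => /andP[Pm mw].
by apply/commute_sym/H; rewrite ?inE ?eqxx ?mw ?orbT.
Qed.

(* Modulo powers of [cls t], elements of the centralizer are words h with
   h t ~ t h.  The part of such an h over the support of t lies in a monoid
   all of whose projections commute with those of t, so two such parts
   commute.  The letters off the support are adjacent to its at least two
   vertices, hence are all on one vertex in a squarefree graph. *)
Lemma centralizer_abelian t l m : squarefree -> cyclically_reduced t ->
  l \in t -> m \in t -> l.1 != m.1 -> is_abelian (centralizer (cls t)).
Proof.
move=> sqG ct lt mt lm g1 g2 /= tg1 tg2.
have [n1 [h1 [E1 ht1]]] := commute_cyclically_reduced ct tg1.
have [n2 [h2 [E2 ht2]]] := commute_cyclically_reduced ct tg2.
(* Powers of [cls t] commute with [g1] and [g2], so they can be divided out. *)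
suff h12 : commute (cls h1) (cls h2).
  apply: (@commute_mulrI _ _ _ (cls t ^+ n2)); last exact/commuteX/commute_sym.
  rewrite E2; apply/commute_sym/(@commute_mulrI _ _ _ (cls t ^+ n1)).
    by rewrite E1; apply: commute_sym.
  rewrite -E2; apply/commute_sym/commuteM; apply/commute_sym/commuteX => //.
  exact/commute_sym/commuteX/commute_refl.
pose P := [pred p : letter G | p.1 \in map fst t].
have PN h p q : teq (h ++ t) (t ++ h) -> p \in h -> ~~ P p -> q \in t -> adj p.1 q.1.
  move=> ht ph Pp qt; apply: contraNT Pp => pq; apply: map_f.
  exact: commuting_trace_sub ht ph qt pq.
have PNC h p q : teq (h ++ t) (t ++ h) -> q \in h -> P p -> ~~ P q ->
    commute (cls [:: p]) (cls [:: q]).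
  move=> ht qh /mapP[p' pt pp'] Pq; apply: cls_adjC.
  by rewrite adj_sym pp'; apply: PN ht _ Pq _.
have NN h h' p q : teq (h ++ t) (t ++ h) -> teq (h' ++ t) (t ++ h') ->
    p \in h -> q \in h' -> ~~ P p -> ~~ P q -> p.1 = q.1.
  move=> ht ht' ph qh Pp Pq.
  have [|/eqP] := sqG _ _ _ _ (PN _ _ _ ht ph Pp lt) (PN _ _ _ ht ph Pp mt)
    (PN _ _ _ ht' qh Pq lt) (PN _ _ _ ht' qh Pq mt); first by [].
  by rewrite (negPf lm).
have split h : teq (h ++ t) (t ++ h) ->
    cls h = cls (filter P h) * cls (filter (predC P) h).
  move=> ht; apply: cls_filter_split => p q _ qh Pp Pq.
  exact: PNC ht qh Pp Pq.
rewrite (split h1) // (split h2) //.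
have PP : commute (cls (filter P h1)) (cls (filter P h2)).
  rewrite /commute -!cls_cat; apply: cls_teq => a b ab.
  have projP h : proj a b (filter P h) = filter P (proj a b h).
    by rewrite /proj -!filter_predI; apply: eq_filter => p /=; rewrite andbC.
  rewrite !proj_cat !projP.
  have [tab|/eqP tab] := eqVneq (proj a b t) [::].
    suff F h : filter P (proj a b h) = [::] by rewrite !F.
    rewrite -filter_predI; apply/eqP; rewrite -[_ == _]negbK -has_filter.
    apply/hasPn=> p _ /=; apply: contra_eqN tab => /andP[/mapP[q qt pq] pab].
    rewrite -has_filter; apply/hasP; exists q => //.
    by rewrite -pq.
  have sub h : teq (h ++ t) (t ++ h) -> filter P (proj a b h) = proj a b h.
    move=> ht; apply/all_filterP/allP=> p.
    have := ht _ _ ab; rewrite !proj_cat => /comm_cat_sub F /(F (introN eqP tab)).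
    by rewrite mem_filter => /andP[_]; apply: map_f.
  rewrite !sub //; apply: (comm_cat_trans (introN eqP tab)).
    by rewrite -!proj_cat ht1.
  by rewrite -!proj_cat ht2.
have PQ h h' : teq (h' ++ t) (t ++ h') ->
    commute (cls (filter P h)) (cls (filter (predC P) h')).
  move=> ht; apply: commute_cls2 => p q; rewrite !mem_filter.
  by move=> /andP[Pp _] /andP[Pq qh]; apply: PNC ht qh Pp Pq.
have QQ : commute (cls (filter (predC P) h1)) (cls (filter (predC P) h2)).
  apply: commute_cls2 => p q; rewrite !mem_filter => /andP[Pp ph] /andP[Pq qh].
  exact/cls_same_vertexC/(NN _ _ _ _ ht1 ht2 ph qh).
apply: commuteM; apply: commute_sym; apply: commuteM.
- exact: commute_sym.
- exact: PQ.
- exact/commute_sym/PQ.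
- exact: commute_sym.
Qed.

Lemma reduced_nseq n l : reduced (nseq n l).
Proof.
elim: n => //= n ->; rewrite andbT; apply/negP=> /acc_mem/nseqP[E _].
by have := inv_letter_neq l; rewrite E eqxx.
Qed.

Lemma reduced_single_vertex l w : reduced (l :: w) ->
  (forall m, m \in w -> m.1 = l.1) -> w = nseq (size w) l.
Proof.
elim: w => //= m w IHw /andP[lm rw] H.
have ml : m = l.
  have := H m; rewrite inE eqxx => /(_ isT).
  move: lm; case: l m {H IHw rw} => [a []] [b []] //= + ab; by rewrite ab ?eqxx.
rewrite ml in rw *; rewrite {1}IHw // => p pw; apply: H.
by rewrite inE pw orbT.
Qed.

(* The inner pearl condition rules out proper powers because the centralizers
   of a letter and of its powers coincide. *)
Lemma inner_pearl_cyclically_reduced t : squarefree ->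
  cyclically_reduced t -> inner_pearl (cls t) ->
  exists2 l, l \in t & cls t = cls [:: l].
Proof.
move=> sqG ct [t_n1 t_nab t_cyc].
case: t => [|l t] // in ct t_n1 t_nab t_cyc *.
exists l; first exact: mem_head.
have tl m : m \in l :: t -> m.1 = l.1.
  move=> mt; apply/eqP; apply: contra_notT t_nab => ml.
  by apply: centralizer_abelian sqG ct mt (mem_head _ _) ml.
have tE : l :: t = nseq (size t).+1 l.
  rewrite /= -reduced_single_vertex //; first by case/andP: ct.
  by move=> m mt; apply: tl; rewrite inE mt orbT.
(* The letter is central in the centralizer of its power [cls (l :: t)], hence by hypothesis a power
   of that element. *)
have l_cyc : cyclic_subgroup (cls (l :: t)) (cls [:: l]).
  rewrite t_cyc; split.
    by rewrite /centralizer /= tE cls_nseq; apply/commute_sym/commuteX.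
  move=> g tg; have [n [h [gE ht]]] := commute_cyclically_reduced ct tg.
  apply: (@commute_mulrI _ _ _ (cls (l :: t) ^+ n)); last first.
    by apply: commuteX; rewrite tE cls_nseq; apply: commuteX.
  rewrite gE; apply: commute_cls => p ph; apply: commute_sym.
  have [|pl] := boolP (adj p.1 l.1); first exact: cls_adjC.
  apply: cls_same_vertexC; apply: tl.
  exact: commuting_trace_sub ht ph (mem_head _ _) pl.
(* Both words are reduced, so their lengths agree; [m] will be [l] or its inverse. *)
have sizeE n m : cls [:: l] = cls (nseq (n * (size t).+1) m) -> size t = 0.
  move/(cls_eq_reduced (reduced_nseq 1 l) (reduced_nseq _ _))/teq_size.
  by rewrite !size_nseq => /esym/eqP; rewrite muln_eq1 => /andP[_ /eqP[]].
suff /size0nil-> : size t = 0 by [].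
case: l_cyc => n; rewrite tE => -[].
  by rewrite cls_nseq -expgnA mulnC -cls_nseq; apply: sizeE.
rewrite cls_nseq -expgnA mulnC -expVgn -cls_inv_letter -cls_nseq; exact: sizeE.
Qed.

Lemma inner_pearl_conj_letter (S : pred G) w : squarefree ->
  all (fun l => S l.1) w -> inner_pearl (cls w) ->
  exists c l, [/\ all (fun m => S m.1) c, S l.1 & cls w = cls [:: l] ^ cls c].
Proof.
move=> sqG Sw w_pearl.
have [c [t [Sc St ct wE]]] := conj_cyclically_reduced Sw.
have t_pearl : inner_pearl (cls t).
  by rewrite -[cls t](conjgK (cls c)) -wE; apply: inner_pearlJ.
have [l lt tE] := inner_pearl_cyclically_reduced sqG ct t_pearl.
by exists c, l; rewrite wE tE; split=> //; apply: (allP St).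
Qed.

(** Modulo powers of the letter, [g] is a word [h] commuting with [[:: l]] as a trace, and a letter
    of [h] on a vertex not adjacent to [l.1] must be [l]. *)
Lemma centralizer_letter l g : commute (cls [:: l]) g ->
  exists2 w, all (fun m => (m.1 == l.1) || adj l.1 m.1) w & g = cls w.
Proof.
move=> lg; have cl : cyclically_reduced [:: l].
  by rewrite /cyclically_reduced /= (eq_sym l (inv_letter l)) inv_letter_neq !andbF.
have [n [h [gE ht]]] := commute_cyclically_reduced cl lg.
exists (h ++ nseq n (inv_letter l)); last first.
  by rewrite cls_cat -gE cls_nseq cls_inv_letter expVgn mulgK.
rewrite all_cat all_nseq /= eqxx orbT andbT; apply/allP=> m mh /=.
have [|ml] := boolP (adj m.1 l.1); first by rewrite adj_sym => ->; rewrite orbT.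
have := commuting_trace_sub ht mh (mem_head _ _) ml.
by rewrite inE => /eqP->; rewrite eqxx.
Qed.

End Centralizers.

(** * Ears *)

Lemma squarefree_iso (G H : sgraph) : graph_iso G H -> squarefree H -> squarefree G.
Proof.
move=> [f [/bij_inj f_inj f_adj]] sqH p q a b; rewrite -!f_adj => pa pb qa qb.
by case: (sqH _ _ _ _ pa pb qa qb) => /f_inj; [left | right].
Qed.

Lemma squarefree_path n : squarefree (path_graph n).
Proof.
move=> p q a b /=; rewrite /path_adj => pa pb qa qb.
case: (eqVneq p q) => [|pq]; [by left | right; apply: val_inj].
by move: pq; rewrite -val_eqE /=; lia.
Qed.

Lemma squarefree_cycle n : n <> 4 -> squarefree (cycle_graph n).
Proof.
move=> n4 p q a b /=.
(* Separating the wrap-around edge turns adjacency modulo [n] into linear arithmetic. *)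
have adjE (i j : 'I_n) : cycle_adj i j -> j = i.+1 :> nat \/ i = j.+1 :> nat \/
    i = 0 :> nat /\ j = n.-1 :> nat \/ j = 0 :> nat /\ i = n.-1 :> nat.
  have ordSE (k : 'I_n) : val (ordS k) = if k.+1 == n then 0 else k.+1.
    rewrite /=; case: eqP => [->|kn]; first by rewrite modnn.
    by rewrite modn_small //; have := ltn_ord k; lia.
  rewrite /cycle_adj -!val_eqE !ordSE /=; have := ltn_ord i; have := ltn_ord j.
  by case: ifP; case: ifP => ? ? ? ? /andP[_]; lia.
move=> /adjE pa /adjE pb /adjE qa /adjE qb.
case: (eqVneq p q) => [|pq]; [by left | right; apply: val_inj].
by move: pq; rewrite -val_eqE /=; have := ltn_ord p; have := ltn_ord q; lia.
Qed.

Lemma squarefree_ear (G : sgraph) :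
  is_ear G -> ~ graph_iso G (cycle_graph 4) -> squarefree G.
Proof.
case=> [] [n [_ Gn]] G4; apply: (squarefree_iso Gn); first exact: squarefree_path.
by apply: squarefree_cycle => n4; apply: G4; rewrite -n4.
Qed.

(** * Vertex bases *)

Section Flip.
Variables (G : sgraph) (s : pred G).

Definition flip_letter (l : letter G) : letter G := (l.1, l.2 (+) s l.1).

Definition flip (x : raag G) : raag G := cls (map flip_letter (word_of_class x)).

(** Independence of the chosen word: flipped inverse pairs still cancel, and letters on adjacent
    vertices commute whatever their signs. *)
Lemma flip_cls w : flip (cls w) = cls (map flip_letter w).
Proof.
suff H u : word_eq (@raag_relators G) u w ->
    cls (map flip_letter u) = cls (map flip_letter w).
  exact/H/word_of_class_eq.
elim=> {u w} [//|u w _ -> //|v u w _ -> _ -> //|u u' w w' _ Eu _ Ew|l|r [a [b [ab ->]]]].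
- by rewrite !map_cat !cls_cat Eu Ew.
- have -> : map flip_letter [:: l; inv_letter l] =
      [:: flip_letter l; inv_letter (flip_letter l)].
    by rewrite /flip_letter /inv_letter /= addNb.
  by rewrite cls_cons cls_inv_letter mulgV.
have -> : map flip_letter (comm_word a b) =
    [:: inv_letter (flip_letter (a, false)), inv_letter (flip_letter (b, false)) &
      map flip_letter [:: (a, false); (b, false)]] by [].
rewrite (cls_cons _ [:: _, _, _ & _]) (cls_cons _ [:: _; _]) (cls_cons _ [:: _]).
rewrite !cls_inv_letter.
have /commgP/eqP : commute (cls [:: flip_letter (a, false)])
    (cls [:: flip_letter (b, false)]) by apply: cls_adjC.
exact.
Qed.

Lemma flipM : {morph flip : x y / x * y}.
Proof.
move=> x y; have [u _ ->] := cls_surj x; have [w _ ->] := cls_surj y.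
by rewrite -cls_cat !flip_cls map_cat cls_cat.
Qed.

Lemma flipK : involutive flip.
Proof.
move=> x; have [u _ ->] := cls_surj x.
by rewrite !flip_cls -map_comp map_id_in // => -[a e] _; rewrite /flip_letter /= addbK.
Qed.

End Flip.

Lemma letters_vertex_basis (G : sgraph) (l m : letter G) (g : raag G) :
  l.1 != m.1 ->
  exists B : G -> raag G, [/\ is_vertex_basis B,
    B l.1 = cls [:: l] ^ g & B m.1 = cls [:: m] ^ g].
Proof.
(* Flip exactly the vertices whose letter is negative; as [l.1] and [m.1] differ, the two signs do
   not interfere. *)
move=> lm; pose s v := (v, true) \in [:: l; m].
pose f (x : raag G) := flip s x ^ g.
have fM : {morph f : x y / x * y} by move=> x y; rewrite /f flipM conjMg.
pose phi : {multiplicative raag G -> raag G} :=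
  HB.pack f (isMultiplicative.Build _ _ f fM).
have fB v : f (raag_gen v) = cls [:: (v, s v)] ^ g by rewrite /f [flip _ _]flip_cls.
exists (fun v => f (raag_gen v)); split.
- exists phi; split=> //; exists (fun x => flip s (x ^ g^-1)) => x.
    by rewrite /= /f conjgK flipK.
  by rewrite /= /f flipK conjgKV.
- rewrite fB; congr (cls [:: _] ^ g); rewrite /s !inE.
  by case: l m lm {s f fM phi fB} => [a []] [b e] /= /negPf ab;
    rewrite !xpair_eqE ?eqxx ab ?andbF.
- rewrite fB; congr (cls [:: _] ^ g); rewrite /s !inE.
  by case: l m lm {s f fM phi fB} => [a e] [b []] /= /negPf ab;
    rewrite !xpair_eqE ?eqxx eq_sym ab ?orbT ?andbF.
Qed.

Theorem proposition3p1 (G : sgraph)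
    (earG : is_ear G) (G_neq_C4 : ~ graph_iso G (cycle_graph 4))
    (x y : raag G) (x_pearl : inner_pearl x) (y_pearl : inner_pearl y)
    (xy_comm : [~ x, y] = 1)
    (z_ex : exists z : raag G, [~ x, z] = 1 /\ [~ y, z] <> 1) :
  exists B : G -> raag G, is_vertex_basis B /\
    exists v w : G, [/\ adj v w, B v = x & B w = y].
Proof.
have sqG := squarefree_ear earG G_neq_C4.
have [u _ xu] := cls_surj x.
have [c [l [_ _ xl]]] : exists c l, [/\ all predT c, predT l.1 & x = cls [:: l] ^ cls c].
  rewrite xu; apply: (inner_pearl_conj_letter (S := predT)) => //; first exact: all_predT.
  by rewrite -xu.
have ly : commute (cls [:: l]) (y ^ (cls c)^-1).
  apply/(commuteJ _ _ (cls c)); rewrite conjgKV -xl.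
  exact/commgP/eqP.
have [w Sw yw] := centralizer_letter ly.
have y'_pearl : inner_pearl (cls w) by rewrite -yw; apply: inner_pearlJ.
have [d [m [Sd Sm wm]]] :=
  inner_pearl_conj_letter (S := fun v => (v == l.1) || adj l.1 v) sqG Sw y'_pearl.
(* As [d] is supported on the star of [l.1], the product of [cls d] and [cls c] conjugates both
   letters at once. *)
have ld : cls [:: l] ^ cls d = cls [:: l].
  apply/conjg_fixP/commgP/commute_cls => p /(allP Sd) /orP[/eqP pl|].
    exact/cls_same_vertexC/esym.
  exact: cls_adjC.
have {}xl : x = cls [:: l] ^ (cls d * cls c) by rewrite conjgM ld.
have ym : y = cls [:: m] ^ (cls d * cls c) by rewrite conjgM -wm -yw conjgKV.
(* On the same vertex, [y] would be [x] or its inverse, so [z] would commute with it. *)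
case/orP: Sm => [/eqP ml|lm].
  case: z_ex => z [xz yz]; case: yz.
  have [] := cls_same_vertex (esym ml) => E; first by rewrite ym E -xl.
  apply/eqP/commgP; rewrite ym E conjVg -xl.
  exact/commute_sym/commuteV/commute_sym/commgP/eqP.
have [|B [basisB Bl Bm]] := @letters_vertex_basis G l m (cls d * cls c).
  by apply: contraTneq lm => ->; rewrite adj_irrefl.
by exists B; split=> //; exists l.1, m.1; rewrite Bl Bm.
Qed.
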